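(* Let $r,p,s,n$ be positive integers such that $p\mid r$, $s\mid r$ and $ps\mid rn$. For $k\ge 0$ let $Q_{r/s}(k)$ be the integer determined by $k=\frac{r}{s}Q_{r/s}(k)+R_{r/s}(k)$. Then, as formal power series in $t,q,a$, $$\Bigg\{\sum_{k\geq 0}t^k\left([Q_{r/s}(k)+1]_{q^{r/s}}+aq\Big[\frac{r}{s}-1\Big]_{aq}[Q_{r/s}(k)]_{q^{r/s}}+aq^{Q_{r/s}(k)\frac{r}{s}+1}[R_{r/s}(k)]_{aq}\right)^n\Bigg\}_{q^p}$$ $$=\frac{\sum_{g\in G(r,p,s,n)}t^{\mathrm{fdes}(g)}q^{\mathrm{fmaj}(g)}a^{\mathrm{col}(g)}}{(1-t)(1-t^rq^r)(1-t^rq^{2r})\cdots(1-t^rq^{(n-1)r})(1-t^{r/s}q^{nr/s})}.$$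
   Context: Notation. For a positive integer $m$, $R_m(i)\in\{0,\ldots,m-1\}$ denotes the residue of $i\in\mathbb Z$ modulo $m$. $[m]_x=1+x+\cdots+x^{m-1}$, with $[0]_x=0$. For a power series $F$, $\{F\}_{q^p}$ is obtained from $F$ by discarding all terms whose degree in $q$ is not divisible by $p$. Groups. $G(r,n)$ is the group of pairs $(c_1,\ldots,c_n;\sigma)$ with $c_i\in\{0,\ldots,r-1\}$ (the colors) and $\sigma\in S_n$, with product $(d_1,\ldots,d_n;\tau)(c_1,\ldots,c_n;\sigma)=(R_r(c_1+d_{\sigma(1)}),\ldots,R_r(c_n+d_{\sigma(n)});\tau\sigma)$. For $p\mid r$, $G(r,p,n)$ is the subgroup of elements with $c_1+\cdots+c_n\equiv 0 \bmod p$. For $s\mid r$ with $ps\mid rn$, $C_s\subseteq G(r,p,n)$ is the cyclic subgroup of order $s$ generated by $(r/s,\ldots,r/s;\mathrm{id})$, and $G(r,p,s,n)=G(r,p,n)/C_s$. Statistics. For $g\in G(r,p,s,n)$ represented by $(c_1,\ldots,c_n;\sigma)$ let $\mathrm{HDes}(g)=\{i\in\{1,\ldots,n-1\}: c_i=c_{i+1},\ \sigma(i)>\sigma(i+1)\}$, $h_i(g)=\#\{j\ge i: j\in\mathrm{HDes}(g)\}$, $k_n(g)=R_{r/s}(c_n)$, $k_i(g)=k_{i+1}(g)+R_r(c_i-c_{i+1})$ for $1\le i\le n-1$, $\lambda_i(g)=r\,h_i(g)+k_i(g)$. Then $\mathrm{fmaj}(g)=\sum_{i=1}^n\lambda_i(g)$,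 $\mathrm{fdes}(g)=\lambda_1(g)$, $\mathrm{col}(g)=\sum_{i=1}^nR_{r/s}(c_i)$. These do not depend on the representative chosen. *)

(* Defs.v *)
From HB Require Import structures.
From mathcomp Require Import all_boot all_order all_algebra all_fingroup.
From mathcomp Require Import boolp.

Set Implicit Arguments.
Unset Strict Implicit.
Unset Printing Implicit Defensive.

Import GRing.Theory.
Local Open Scope ring_scope.

Record fps (R : Type) := Fps { fcoef : nat -> R }.
Add Printing Constructor fps.

Lemma fpsP (R : Type) (f g : fps R) : (forall k, fcoef f k = fcoef g k) -> f = g.
Proof. by case: f g => [f] [g] /= fg; congr Fps; apply: funext. Qed.

HB.instance Definition _ (R : Type) := gen_eqMixin (fps R).
HB.instance Definition _ (R : Type) := gen_choiceMixin (fps R).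

Section FpsRing.
Variable R : comNzRingType.
Implicit Types f g h : fps R.

Definition fps_zero : fps R := Fps (fun=> 0).
Definition fps_opp f : fps R := Fps (fun k => - fcoef f k).
Definition fps_add f g : fps R := Fps (fun k => fcoef f k + fcoef g k).

Fact fps_addA : associative fps_add.
Proof. by move=> f g h; apply: fpsP => k /=; rewrite addrA. Qed.
Fact fps_addC : commutative fps_add.
Proof. by move=> f g; apply: fpsP => k /=; rewrite addrC. Qed.
Fact fps_add0 : left_id fps_zero fps_add.
Proof. by move=> f; apply: fpsP => k /=; rewrite add0r. Qed.
Fact fps_addN : left_inverse fps_zero fps_opp fps_add.
Proof. by move=> f; apply: fpsP => k /=; rewrite addNr. Qed.

HB.instance Definition _ :=
  GRing.isZmodule.Build (fps R) fps_addA fps_addC fps_add0 fps_addN.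

Definition fps_one : fps R := Fps (fun k => (k == 0)%:R).
Definition fps_mul f g : fps R :=
  Fps (fun k => \sum_(i < k.+1) fcoef f i * fcoef g (k - i)).

Let trunc f N : {poly R} := \poly_(i < N) fcoef f i.

Let coef_trunc f N k : (k < N)%N -> (trunc f N)`_k = fcoef f k.
Proof. by move=> kN; rewrite coef_poly kN. Qed.

Let coef_trunc_mul f g N k : (k < N)%N ->
  (trunc f N * trunc g N)`_k = fcoef (fps_mul f g) k.
Proof.
move=> kN; rewrite coefM; apply: eq_bigr => i _.
by rewrite !coef_trunc //; apply: leq_ltn_trans kN; rewrite ?leq_subr // -ltnS.
Qed.

Fact fps_mulC : commutative fps_mul.
Proof.
by move=> f g; apply: fpsP => k; rewrite -!(coef_trunc_mul _ _ (ltnSn k)) mulrC.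
Qed.

Fact fps_mulA : associative fps_mul.
Proof.
move=> f g h; apply: fpsP => k; pose N := k.+1.
transitivity ((trunc f N * trunc g N * trunc h N)`_k).
  rewrite -mulrA coefM; apply: eq_bigr => i _.
  by rewrite coef_trunc ?ltn_ord // coef_trunc_mul // ltnS leq_subr.
rewrite coefM; apply: eq_bigr => i _.
by rewrite coef_trunc_mul ?ltn_ord // coef_trunc // ltnS leq_subr.
Qed.

Fact fps_mul1 : left_id fps_one fps_mul.
Proof.
move=> f; apply: fpsP => k /=.
by rewrite big_ord_recl /= mul1r subn0 big1 ?addr0 // => i _; rewrite mul0r.
Qed.

Fact fps_mulDl : left_distributive fps_mul +%R.
Proof.
move=> f g h; apply: fpsP => k /=.
by rewrite -big_split; apply: eq_bigr => i _; rewrite mulrDl.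
Qed.

Fact fps_oner_neq0 : fps_one != 0.
Proof.
by apply/eqP => /(congr1 (fun f => fcoef f 0)) /= /eqP; rewrite oner_eq0.
Qed.

HB.instance Definition _ := GRing.Zmodule_isComNzRing.Build (fps R)
  fps_mulA fps_mulC fps_mul1 fps_mulDl fps_oner_neq0.

Definition fpsX : fps R := Fps (fun k => (k == 1)%:R).
Definition fpsC (c : R) : fps R := Fps (fun k => if k is 0 then c else 0).

Lemma fcoefD f g k : fcoef (f + g) k = fcoef f k + fcoef g k.
Proof. by []. Qed.

Lemma fcoefM f g k :
  fcoef (f * g) k = \sum_(i < k.+1) fcoef f i * fcoef g (k - i).
Proof. by []. Qed.

Lemma fcoef1 k : fcoef (1 : fps R) k = (k == 0)%:R.
Proof. by []. Qed.

Lemma fcoef_sum I (s : seq I) (P : pred I) (u : I -> fps R) k :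
  fcoef (\sum_(i <- s | P i) u i) k = \sum_(i <- s | P i) fcoef (u i) k.
Proof. by apply: (big_morph (fun f => fcoef f k)). Qed.

Lemma fcoefXnM j f k :
  fcoef (fpsX ^+ j * f) k = if (k < j)%N then 0 else fcoef f (k - j).
Proof.
elim: j k => [|j IHj] k; first by rewrite mul1r subn0.
rewrite exprS -mulrA fcoefM; case: k => [|k].
  by rewrite big_ord1 mul0r.
rewrite big_ord_recl mul0r add0r big_ord_recl mul1r [X in _ + X]big1 ?addr0.
  by rewrite lift0 subSS subn0 IHj.
by move=> i _; rewrite mul0r.
Qed.

(* The infinite sum of the series X^k u_k over k >= 0: only the terms of index
   at most k contribute to the coefficient of X^k. *)
Definition fps_sumX (u : nat -> fps R) : fps R :=
  Fps (fun k => fcoef (\sum_(j < k.+1) fpsX ^+ j * u j) k).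

Lemma fcoef_sumX (u : nat -> fps R) k N : (k < N)%N ->
  fcoef (\sum_(j < N) fpsX ^+ j * u j) k = fcoef (fps_sumX u) k.
Proof.
move=> kN; rewrite -[RHS]/(fcoef (\sum_(j < k.+1) fpsX ^+ j * u j) k) !fcoef_sum.
rewrite (big_ord_widen _ (fun j => fcoef (fpsX ^+ j * u j) k) kN) [RHS]big_mkcond.
by apply: eq_bigr => i _; rewrite fcoefXnM ltnS; case: leqP.
Qed.

End FpsRing.

Arguments fpsX {R}.

Section FpsUnitRing.
Variable R : comUnitRingType.
Implicit Types f g : fps R.

Definition fps_unit : pred (fps R) := fun f => fcoef f 0 \is a GRing.unit.

(* The first k coefficients of the inverse of f. *)
Fixpoint fps_inv_seq f (k : nat) : seq R :=
  if k is m.+1 then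
    let s := fps_inv_seq f m in
    rcons s ((fcoef f 0)^-1 *
      ((m == 0)%:R - \sum_(i < m) s`_i * fcoef f (m - i)))
  else [::].

Definition fps_inv f : fps R :=
  if fps_unit f then Fps (fun k => (fps_inv_seq f k.+1)`_k) else f.

Let size_inv_seq f k : size (fps_inv_seq f k) = k.
Proof. by elim: k => //= k IHk; rewrite size_rcons IHk. Qed.

Let nth_inv_seq f k i : (i < k)%N ->
  (fps_inv_seq f k)`_i = (fps_inv_seq f i.+1)`_i.
Proof.
elim: k => // k IHk; rewrite ltnS leq_eqVlt => /predU1P[-> // | ik].
by rewrite [LHS]/= nth_rcons size_inv_seq ik IHk.
Qed.

Fact fps_mulVr : {in fps_unit, left_inverse 1 fps_inv *%R}.
Proof.
move=> f Uf; apply: fpsP => k; have Uf0 : fcoef f 0 \is a GRing.unit by [].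
rewrite /fps_inv [fps_unit f]Uf fcoefM big_ord_recr subnn [fcoef _ ord_max]/=.
rewrite nth_rcons size_inv_seq ltnn eqxx mulrC mulVKr // fcoef1.
set S := \sum_(i < k) (_ * _); set T := bigop.body _ _ _.
have -> : T = S by apply: eq_bigr => i _; rewrite (nth_inv_seq f (ltn_ord i)).
exact: subrKC.
Qed.

Fact fps_unitP f g : g * f = 1 -> fps_unit f.
Proof.
move/(congr1 (fun h => fcoef h 0)); rewrite fcoefM fcoef1 big_ord1 /= => gf.
by apply/unitrPr; exists (fcoef g 0); rewrite mulrC.
Qed.

Fact fps_inv_out : {in [predC fps_unit], fps_inv =1 id}.
Proof. by move=> f; rewrite inE /fps_inv => /negbTE Uf; rewrite [fps_unit f]Uf. Qed.

HB.instance Definition _ := GRing.ComNzRing_hasMulInverse.Build (fps R)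
  fps_mulVr fps_unitP fps_inv_out.

Lemma fps_unitE f : (f \is a GRing.unit) = (fcoef f 0 \is a GRing.unit).
Proof. by []. Qed.

End FpsUnitRing.

(* Z[[t, q, a]], built as Z[[a]][[q]][[t]] *)
Notation Ztqa := (fps (fps (fps int))).
Definition vart : Ztqa := fpsX.
Definition varq : Ztqa := fpsC fpsX.
Definition vara : Ztqa := fpsC (fpsC fpsX).

(* {F}_{q^p} *)
Definition keep_q (p : nat) (F : Ztqa) : Ztqa :=
  Fps (fun k => Fps (fun j =>
    if (p %| j)%N then fcoef (fcoef F k) j else 0)).

Definition qnat (R : pzSemiRingType) (m : nat) (x : R) : R :=
  \sum_(i < m) x ^+ i.

(* The carrier 'I_r.-1.+1 of the colors is 'I_r for r > 0; this form carries
   the addition modulo r. *)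
Record cperm (r n : nat) := CPerm {
  colors : {ffun 'I_n -> 'I_r.-1.+1};
  uncolored : 'S_n }.

Section ColoredPerm.
Variables r n : nat.
Implicit Types g h : cperm r n.

Definition cperm_pair g := (colors g, uncolored g).
Definition pair_cperm u : cperm r n := CPerm u.1 u.2.
Fact cperm_pairK : cancel cperm_pair pair_cperm. Proof. by case. Qed.

HB.instance Definition _ := Finite.copy (cperm r n) (can_type cperm_pairK).

(* In MathComp, (s * t) i = t (s i) for permutations s and t. *)
Definition cperm_mul g h : cperm r n :=
  CPerm [ffun i => colors h i + colors g (uncolored h i)]
        (uncolored h * uncolored g)%g.
Definition cperm_one : cperm r n := CPerm [ffun=> 0] 1%g.
Definition cperm_inv g : cperm r n :=
  CPerm [ffun i => - colors g ((uncolored g)^-1%g i)] (uncolored g)^-1%g.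

Fact cperm_mulA : associative cperm_mul.
Proof.
case=> [c1 s1] [c2 s2] [c3 s3]; congr CPerm; last by rewrite mulgA.
by apply/ffunP => i; rewrite !ffunE /= addrA permM.
Qed.
Fact cperm_mul1 : left_id cperm_one cperm_mul.
Proof.
case=> [c s]; congr CPerm; last by rewrite mulg1.
by apply/ffunP => i; rewrite !ffunE addr0.
Qed.
Fact cperm_mulV : left_inverse cperm_one cperm_inv cperm_mul.
Proof.
case=> [c s]; congr CPerm; last by rewrite mulgV.
by apply/ffunP => i; rewrite !ffunE /= permK subrr.
Qed.

HB.instance Definition _ := Finite_isGroup.Build (cperm r n)
  cperm_mulA cperm_mul1 cperm_mulV.

End ColoredPerm.

Definition Grpn (r p n : nat) : {set cperm r n} :=
  [set g | (p %| \sum_(i < n) colors g i)%N].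

Definition Cs_gen (r s n : nat) : cperm r n :=
  CPerm [ffun=> inord (r %/ s %% r)] 1%g.

Definition Cs (r s n : nat) : {group cperm r n} := <[Cs_gen r s n]>%G.

Definition Grpsn (r p s n : nat) : {set coset_of (Cs r s n)} :=
  (Grpn r p n / Cs r s n)%g.

Section GroupFacts.
Variables r n : nat.

Let sum_colors_mod p (c d : 'I_n -> 'I_r.-1.+1) : (p %| r)%N -> (0 < r)%N ->
  \sum_(i < n) (c i + d i)%R = \sum_(i < n) (c i : nat) + \sum_(i < n) (d i : nat)
    %[mod p].
Proof.
move=> pr r0; rewrite -big_split.
elim/big_ind2: _ => // [x1 x2 y1 y2 E1 E2|i _].
  by rewrite -modnDm E1 E2 modnDm.
by rewrite /= modn_dvdm // prednK.
Qed.

Lemma group_set_Grpn p : (0 < r)%N -> (p %| r)%N -> group_set (Grpn r p n).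
Proof.
move=> r0 pr; apply/group_setP; split.
  by rewrite inE big1 // => i _; rewrite ffunE.
move=> g h; rewrite !inE => gp hp.
under eq_bigr do rewrite ffunE.
rewrite /dvdn (sum_colors_mod _ (fun i => colors g (uncolored h i)) pr r0).
have <- : (\sum_(i < n) colors g i = \sum_(i < n) colors g (uncolored h i))%N.
  by rewrite [LHS](reindex_inj (@perm_inj _ (uncolored h))).
by rewrite -/(dvdn _ _) dvdn_add.
Qed.

Lemma Cs_sub_Grpn p s : (0 < r)%N -> (0 < s)%N -> (p %| r)%N -> (s %| r)%N ->
  (p * s %| r * n)%N -> Cs r s n \subset Grpn r p n.
Proof.
move=> r0 s0 pr sr psrn.
pose G := Group (group_set_Grpn r0 pr); rewrite -[Grpn r p n]/(gval G).
rewrite cycle_subG inE.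
under eq_bigr do rewrite ffunE inordK ?prednK ?ltn_pmod //.
rewrite sum_nat_const card_ord -(dvdn_pmul2r s0) -mulnA.
have [-> | s1] := eqVneq s 1; first by rewrite divn1 modnn mul0n muln0.
have s_gt1 : (1 < s)%N by rewrite ltn_neqAle eq_sym s1.
by rewrite modn_small ?ltn_Pdiv // divnK // [(n * r)%N]mulnC.
Qed.

Lemma Cs_norm s (A : {set cperm r n}) : A \subset 'N(Cs r s n)%g.
Proof.
apply: subset_trans (cent_sub _); rewrite cent_cycle.
apply/subsetP => g _; apply/cent1P; case: g => c t.
congr CPerm; last by rewrite mulg1 mul1g.
by apply/ffunP => i; rewrite !ffunE /= perm1 addrC.
Qed.

End GroupFacts.

(* R_m(i) *)
Definition residue (m : nat) (i : int) : nat := `|(i %% m)%Z|%N.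

Section Statistics.
Variables r s n : nat.

Section OnRepresentatives.
Variable g : cperm r n.

(* Positions are numbered from 0 to n - 1: colorn i and permn i stand for
   c_{i+1} and sigma(i+1) - 1.  The value for i >= n is never used. *)
Definition colorn (i : nat) : nat :=
  if insub i is Some j then colors g j else 0%N.
Definition permn (i : nat) : nat :=
  if insub i is Some j then uncolored g j else 0%N.

Definition HDes : {set 'I_n} :=
  [set i : 'I_n | [&& i.+1 < n, colorn i == colorn i.+1
                                & permn i > permn i.+1]%N].

Definition hstat (i : nat) : nat := #|[set j in HDes | (i <= j)%N]|.

(* kdown m is k_{n-m} in the numbering of positions from 1 to n. *)
Fixpoint kdown (m : nat) : nat :=
  if m is m'.+1 then
    let i := (n.-1 - m)%N in
    (kdown m' + residue r ((colorn i)%:Z - (colorn i.+1)%:Z))%N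
  else residue (r %/ s) (colorn n.-1)%:Z.

Definition kstat (i : nat) : nat := kdown (n.-1 - i).

Definition lambdastat (i : nat) : nat := (r * hstat i + kstat i)%N.

Lemma kstat_last : kstat n.-1 = residue (r %/ s) (colorn n.-1)%:Z.
Proof. by rewrite /kstat subnn. Qed.

Lemma kstat_step i : (i.+1 < n)%N ->
  kstat i = (kstat i.+1 + residue r ((colorn i)%:Z - (colorn i.+1)%:Z))%N.
Proof.
move=> lt_i_n; have lt_i_n1 : (i < n.-1)%N by rewrite -ltnS (ltn_predK lt_i_n).
rewrite /kstat -subnSK //= subnSK // subKn //; exact: ltnW.
Qed.

Definition fdes_rep : nat := lambdastat 0.
Definition fmaj_rep : nat := (\sum_(i < n) lambdastat i)%N.
Definition col_rep : nat := (\sum_(i < n) residue (r %/ s) (colorn i)%:Z)%N.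

End OnRepresentatives.

Definition fdes (x : coset_of (Cs r s n)) : nat := fdes_rep (repr x).
Definition fmaj (x : coset_of (Cs r s n)) : nat := fmaj_rep (repr x).
Definition colstat (x : coset_of (Cs r s n)) : nat := col_rep (repr x).

End Statistics.

Section RepresentativeIndependence.
Variables r s n : nat.
Hypotheses (r_gt0 : (0 < r)%N) (s_gt0 : (0 < s)%N) (s_dvd_r : (s %| r)%N).
Implicit Types (g h : cperm r n) (x : coset_of (Cs r s n)).

Let z := Cs_gen r s n.

Let colorn_shift g i : (i < n)%N ->
  ((colorn (z * g)%g i)%:Z = (colorn g i)%:Z + (r %/ s)%:Z %[mod r])%Z.
Proof.
move=> lt_in; rewrite /colorn insubT /= ffunE /= ffunE /= inordK; last first.
  by rewrite prednK ?ltn_pmod.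
move: (nat_of_ord (colors g _)) => c; rewrite prednK // modnDmr.
by rewrite -PoszD !modz_nat modn_mod.
Qed.

Let colorn_eq g i j : (i < n)%N -> (j < n)%N ->
  (colorn (z * g)%g i == colorn (z * g)%g j) = (colorn g i == colorn g j).
Proof.
move=> lt_in lt_jn; rewrite /colorn !insubT !(val_eqE, ffunE).
by rewrite (inj_eq (addIr _)).
Qed.

Let permn_shift g i : permn (z * g)%g i = permn g i.
Proof. by rewrite /permn; case: insubP => // j _ _; rewrite permM perm1. Qed.

Let HDes_shift g : HDes (z * g)%g = HDes g.
Proof.
apply/setP => i; rewrite !inE !permn_shift; case: ltnP => //= lt_in.
by rewrite colorn_eq.
Qed.

Let m_dvd_r : ((r %/ s)%:Z %| r%:Z)%Z.
Proof. by rewrite dvdzE /=; apply/dvdnP; exists s; rewrite mulnC divnK. Qed.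

Let residue_shift g i : (i < n)%N ->
  residue (r %/ s) (colorn (z * g)%g i)%:Z = residue (r %/ s) (colorn g i)%:Z.
Proof.
move=> lt_in; rewrite /residue; congr `|_|%N; apply/eqP.
have /eqP := colorn_shift g lt_in; rewrite !eqz_mod_dvd => /(dvdz_trans m_dvd_r).
by rewrite opprD addrA rpredBr // dvdzz.
Qed.

Let residue_sub_shift g i j : (i < n)%N -> (j < n)%N ->
  residue r ((colorn (z * g)%g i)%:Z - (colorn (z * g)%g j)%:Z) =
  residue r ((colorn g i)%:Z - (colorn g j)%:Z).
Proof.
move=> lt_in lt_jn; rewrite /residue; congr `|_|%N.
rewrite -modzDm -modzNm !colorn_shift // modzNm modzDm.
by rewrite opprD addrACA subrr addr0.
Qed.

Let lambda_shift g i : (i < n)%N -> lambdastat s (z * g)%g i = lambdastat s g i.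
Proof.
move=> lt_in; have n_gt0 := leq_ltn_trans (leq0n i) lt_in.
have lt_n1n : (n.-1 < n)%N by rewrite prednK.
rewrite /lambdastat /hstat HDes_shift; congr (_ + _)%N; rewrite /kstat.
elim: (n.-1 - i)%N (leq_subr i n.-1) => [|k IHk] le_k; first exact: residue_shift.
have lt_kn j : (n.-1 - j < n)%N by apply: leq_ltn_trans lt_n1n; apply: leq_subr.
by rewrite /= IHk ?(ltnW le_k) // residue_sub_shift // subnSK.
Qed.

Lemma stats_shift g :
  [/\ (0 < n)%N -> fdes_rep s (z * g)%g = fdes_rep s g,
      fmaj_rep s (z * g)%g = fmaj_rep s g & col_rep s (z * g)%g = col_rep s g].
Proof.
split; first exact: lambda_shift.
  by apply: eq_bigr => i _; apply: lambda_shift.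
by apply: eq_bigr => i _; apply: residue_shift.
Qed.

Lemma stats_repr x g : (0 < n)%N -> g \in (x : {set _}) ->
  [/\ fdes x = fdes_rep s g, fmaj x = fmaj_rep s g & colstat x = col_rep s g].
Proof.
move=> n_gt0 xg; rewrite /fdes /fmaj /colstat.
have: repr x \in (Cs r s n :* g)%g.
  by rewrite -(coset_mem xg) val_coset ?mem_repr_rcoset // (subsetP (Cs_norm _ [set: _])) ?inE.
case/rcosetP => _ /cycleP[j ->] ->; elim: j => [|j [IH1 IH2 IH3]].
  by rewrite expg0 mul1g.
by rewrite expgS -mulgA; have [-> // -> ->] := stats_shift (z ^+ j * g)%g.
Qed.

End RepresentativeIndependence.

(* Main.v *)
Require Import Defs.
From mathcomp Require Import all_boot all_order all_algebra all_fingroup.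
From mathcomp Require Import zify ring.

Set Implicit Arguments.
Unset Strict Implicit.
Unset Printing Implicit Defensive.

Import GRing.Theory.
Local Open Scope ring_scope.

(* The base of the k-th power is the sum of q^f a^(f mod m) over 0 <= f <= k,
   where m = r/s.  Hence the coefficient of t^k on the left is the sum of
   q^|f| a^(sum of the f_i mod m) over the f in {0..k}^n with p | |f|.
   Expanding the geometric series on the right, its coefficient of t^k is a sum
   over pairs (g, mu), with g a group element and mu in N^n.  Choose the
   representative of g = (c; sigma) whose last color is less than m.  The pair
   corresponds to the map f given by
     f(sigma(i)) = lambda_i(g) + sum_{j >= i} w_j mu_j,
   with w_j = r for j < n and w_n = m: the exponent of t becomes the largest
   value of f.  Conversely sigma sorts f decreasingly, ties being kept in
   increasing order, c is read off the values of f modulo r, and mu off their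
   successive differences. *)

(** * Permutations sorting a finite strict total order *)

Section SortingPermutation.
Variables (n : nat) (lt : rel 'I_n).
Hypotheses (lt_irr : irreflexive lt) (lt_trans : transitive lt).
Hypothesis lt_total : forall x y, x != y -> lt x y || lt y x.

Definition strictly_sorts (s : 'S_n) :=
  forall i j : 'I_n, (i < j)%N -> lt (s i) (s j).

Let lower x := [set y | lt y x].

Let card_lower_lt x : (#|lower x| < n)%N.
Proof.
rewrite -[X in (_ < X)%N](card_ord n) -cardsT; apply: proper_card.
by apply/properP; split=> //; exists x; rewrite ?inE ?lt_irr.
Qed.

Let card_lowerS x y : lt x y -> (#|lower x| < #|lower y|)%N.
Proof.
move=> xy; apply: proper_card; apply/properP; split; last first.
  by exists x; rewrite !inE ?lt_irr.
by apply/subsetP => z; rewrite !inE => zx; apply: lt_trans xy.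
Qed.

Let rank x : 'I_n := Ordinal (card_lower_lt x).

Let rank_inj : injective rank.
Proof.
move=> x y /(congr1 val) /= exy; apply/eqP; apply: contraT => /lt_total.
by case/orP => /card_lowerS; rewrite exy ltnn.
Qed.

(** The rank of an element, the number of elements below it, increases strictly along [lt]. It is
    therefore a permutation, and its inverse lists the elements in order. *)
Lemma strictly_sorts_exists : exists s, strictly_sorts s.
Proof.
exists (perm rank_inj)^-1%g => i j ij.
set s := (_^-1)%g; have rs k : rank (s k) = k by rewrite -(permE rank_inj) permKV.
have [sij | /lt_total] := eqVneq (s i) (s j).
  by move: ij; rewrite (perm_inj sij) ltnn.
case/orP => // /card_lowerS; rewrite -[#|lower (s j)|]/(val (rank (s j))).
by rewrite -[#|lower (s i)|]/(val (rank (s i))) !rs ltnNge ltnW.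
Qed.

(** A sorting permutation carries the positions below [j] onto the elements below its value at [j].
    That value thus has rank [j], and ranks are injective. *)
Lemma strictly_sorts_inj s s' : strictly_sorts s -> strictly_sorts s' -> s = s'.
Proof.
have rank_s u (j : 'I_n) : strictly_sorts u ->
      #|lower (u j)| = #|[set i : 'I_n | (i < j)%N]|.
  move=> us; rewrite -(card_preimset (lower (u j)) (@perm_inj _ u)).
  apply: eq_card => i; rewrite !inE.
  have [ij|] := ltnP i j; first exact: us.
  rewrite leq_eqVlt => /predU1P[/val_inj -> | /us uji]; first exact: lt_irr.
  by apply/negP => /(lt_trans uji); rewrite lt_irr.
move=> ss ss'; apply/permP => j; apply: rank_inj; apply: val_inj.
by rewrite /= !rank_s.
Qed.

End SortingPermutation.

Lemma strictly_sorts_step n (lt : rel 'I_n.+1) (s : 'S_n.+1) :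
    transitive lt ->
    (forall i, (i < n)%N -> lt (s (inord i)) (s (inord i.+1))) ->
  strictly_sorts lt s.
Proof.
move=> lt_trans step i j; rewrite -[in lt _ _](inord_val j).
elim: (nat_of_ord j) (leq_ord j) => // k IHk lt_kn; rewrite ltnS leq_eqVlt.
case/predU1P=> [ik | ik]; first by have:= step k lt_kn; rewrite -ik inord_val.
by apply: lt_trans (step _ lt_kn); apply: IHk => //; apply: ltnW.
Qed.

(** * The order by decreasing values, and residues of differences *)

Definition before n (f : 'I_n -> nat) : rel 'I_n :=
  fun x y => (f y < f x)%N || (f x == f y) && (x < y)%N.

Lemma before_irr n (f : 'I_n -> nat) : irreflexive (before f).
Proof. by move=> x; rewrite /before !ltnn andbF. Qed.

Lemma before_trans n (f : 'I_n -> nat) : transitive (before f).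
Proof. move=> y x z; rewrite /before; lia. Qed.

Lemma before_total n (f : 'I_n -> nat) x y :
  x != y -> before f x y || before f y x.
Proof. rewrite -val_eqE /before /=; lia. Qed.

Lemma residue_nat m c : residue m c%:Z = (c %% m)%N.
Proof. by rewrite /residue modz_nat. Qed.

Lemma residueB_eq r c d e : (c = d + e %[mod r])%N ->
  residue r (c%:Z - d%:Z) = (e %% r)%N.
Proof.
move=> ce; rewrite -residue_nat /residue; congr `|_|%N.
by rewrite -modzDml modz_nat ce -modz_nat modzDml PoszD addrC addKr.
Qed.

Lemma residueBK r c d : (0 < r)%N ->
  (residue r (c%:Z - d%:Z) + d = c %[mod r])%N.
Proof.
move=> r0; apply/eqP; rewrite -eqz_nat -!modz_nat PoszD /residue.
rewrite gez0_abs ?modz_ge0 ?lt0n_neq0 ?eqz_nat -?lt0n //.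
by rewrite modzDml subrK.
Qed.

(** * The values attached to a pair (g, mu) and their recurrence *)

Section Values.
Variables (r s n : nat).
Local Notation m := (r %/ s)%N.
Implicit Types (g : cperm r n.+1) (mu : 'I_n.+1 -> nat).

Lemma colornE g (i : 'I_n.+1) : colorn g i = colors g i.
Proof. by rewrite /colorn valK. Qed.

Lemma permnE g (i : 'I_n.+1) : permn g i = uncolored g i.
Proof. by rewrite /permn valK. Qed.

Lemma colorn_inord g i : (i <= n)%N -> colorn g i = colors g (inord i).
Proof. by move=> le_in; rewrite -colornE inordK. Qed.

Lemma permn_inord g i : (i <= n)%N -> permn g i = uncolored g (inord i).
Proof. by move=> le_in; rewrite -permnE inordK. Qed.

(* The exponent of t in the j-th geometric factor of the denominator. *)
Definition weight (j : nat) : nat := if j == n then m else r.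

Definition value g mu (i : nat) : nat :=
  (lambdastat s g i + \sum_(j < n.+1 | (i <= j)%N) weight j * mu j)%N.

Lemma hstat_step g i : (i < n)%N ->
  hstat g i = ((inord i \in HDes g) + hstat g i.+1)%N.
Proof.
move=> lt_in; rewrite /hstat (cardsD1 (inord i)) !inE inordK ?leqnn ?andbT //;
  last exact: ltnW.
congr (_ + #|pred_of_set _|)%N; apply/setP => j.
rewrite !inE -val_eqE /= inordK; last exact: ltnW.
by rewrite [(i < j)%N]ltn_neqAle eq_sym andbCA.
Qed.

Lemma hstat_last g : hstat g n = 0%N.
Proof.
apply: eq_card0 => j; rewrite !inE ltnS.
by rewrite [(j < n)%N]ltnNge; case: (n <= j)%N; rewrite ?andbF.
Qed.

(** Passing from [i.+1] to [i] adds at most one descent to h, one color residue to k, and the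
    summand [j = i], whose weight is [r] because [i < n]. Sorting and decoding both rest on this
    recurrence. *)
Lemma value_step g mu i : (i < n)%N ->
  value g mu i = (value g mu i.+1 +
    (r * ((inord i \in HDes g) + mu (inord i))
     + residue r ((colorn g i)%:Z - (colorn g i.+1)%:Z)))%N.
Proof.
move=> lt_in; rewrite /value /lambdastat (kstat_step s) ?ltnS // hstat_step //.
have Ei : (inord i : 'I_n.+1) = i :> nat by rewrite inordK // ltnW.
rewrite (bigD1 (inord i)) /= ?Ei // [weight i]/weight (ltn_eqF lt_in).
set S := bigop.body _ _ _; set T := bigop.body _ _ _.
have -> : S = T.
  apply: eq_bigl => j; rewrite -val_eqE /= Ei ltn_neqAle eq_sym andbC.
  by [].
lia.
Qed.

(** The bound makes k_n the last color itself, so this color and [mu ord_max] are the remainder and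
    the quotient of the value by [m]. *)
Lemma value_last g mu : (colorn g n < m)%N ->
  value g mu n = (colorn g n + m * mu ord_max)%N.
Proof.
move=> lt_cm; rewrite /value /lambdastat hstat_last (kstat_last s g) /= muln0 add0n.
rewrite residue_nat modn_small //; congr (_ + _)%N.
rewrite (big_pred1 ord_max) => [|j]; first by rewrite /weight eqxx.
by rewrite /= -val_eqE /= eqn_leq leq_ord.
Qed.

Lemma HDesP g i : (i < n)%N -> (inord i \in HDes g) =
  (colorn g i == colorn g i.+1)
    && (uncolored g (inord i.+1) < uncolored g (inord i))%N.
Proof.
move=> lt_in; have le_in := ltnW lt_in.
by rewrite inE inordK // ltnS lt_in -!permn_inord.
Qed.

Hypothesis r_gt0 : (0 < r)%N.

Lemma colorn_lt g i : (colorn g i < r)%N.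
Proof.
by rewrite /colorn; case: insubP => //= j _ _; rewrite -[X in (_ < X)%N](prednK r_gt0).
Qed.

(** Modulo [r] the color differences telescope, while the descents and the [mu j] with [j < n]
    disappear. Only the last value leaves a shift, common to all positions. *)
Lemma value_modr g mu i : (colorn g n < m)%N -> (i <= n)%N ->
  (value g mu i = colorn g i + m * mu ord_max %[mod r])%N.
Proof.
move=> lt_cm le_in; rewrite -(subKn le_in).
elim: (n - i)%N (leq_subr i n) => [|k IHk] lt_kn; first by rewrite subn0 value_last.
have lt_n : (n - k.+1 < n)%N by lia.
have E : (n - k.+1).+1 = (n - k)%N by lia.
have := residueBK (colorn g (n - k.+1)) (colorn g (n - k)) r_gt0.
rewrite value_step // E; set R := residue _ _ => RE.
rewrite addnCA mulnC modnMDl -modnDml IHk 1?ltnW // modnDml.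
by rewrite addnC addnA -modnDml RE modnDml.
Qed.

(* A descent of g at equal colors raises lambda by r, so equal consecutive
   values can only occur at ascents. *)
Lemma value_sorts g mu (f : 'I_n.+1 -> nat) :
    (forall i, (i <= n)%N -> f (uncolored g (inord i)) = value g mu i) ->
  strictly_sorts (before f) (uncolored g).
Proof.
move=> fE; apply: strictly_sorts_step (@before_trans _ f) _ => i lt_in.
have le_in := ltnW lt_in; rewrite /before !fE // (value_step _ _ lt_in) HDesP //.
set x := uncolored _ _; set y := uncolored _ _; set R := residue _ _.
have xy : x != y :> nat.
  by rewrite val_eqE /x /y (inj_eq perm_inj) -val_eqE /= !inordK // eq_sym ltn_eqF.
case: (posnP R) => [R0 | ]; last by lia.
have -> : colorn g i == colorn g i.+1.
  have := residueBK (colorn g i) (colorn g i.+1) r_gt0.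
  by rewrite -/R R0 add0n !modn_small ?colorn_lt // => ->.
rewrite /=; case: (ltngtP x y) xy => //= [_|_] _; last by nia.
case: (mu _) => [|k]; nia.
Qed.

End Values.

(** * The bijection between pairs and maps *)

Section Encoding.
Variables (r s n : nat).
Hypotheses (r_gt0 : (0 < r)%N) (s_dvd_r : (s %| r)%N).
Local Notation m := (r %/ s)%N.
Implicit Types (g : cperm r n.+1) (mu f : 'I_n.+1 -> nat).

Let m_dvd_r : (m %| r)%N.
Proof. by apply/dvdnP; exists s; rewrite mulnC divnK. Qed.

Let m_gt0 : (0 < m)%N.
Proof. exact: dvdn_gt0 m_dvd_r. Qed.

Definition encode g mu (x : 'I_n.+1) : nat := value s g mu ((uncolored g)^-1%g x).

Lemma encode_perm g mu i : encode g mu (uncolored g i) = value s g mu i.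
Proof. by rewrite /encode permK. Qed.

Lemma sum_encode (F : nat -> nat) g mu :
  (\sum_x F (encode g mu x) = \sum_(i < n.+1) F (value s g mu i))%N.
Proof.
rewrite (reindex_inj (@perm_inj _ (uncolored g))).
by apply: eq_bigr => i _; rewrite encode_perm.
Qed.

(** Exchanging the sums counts [mu j] once for each position up to [j], whence the factor [j.+1]. *)
Lemma sum_value g mu : (\sum_(i < n.+1) value s g mu i =
  fmaj_rep s g + \sum_(j < n.+1) j.+1 * (weight r s n j * mu j))%N.
Proof.
rewrite big_split; congr (_ + _)%N.
under eq_bigr do rewrite big_mkcond.
rewrite exchange_big; apply: eq_bigr => j _.
rewrite -big_mkcond sum_nat_const; congr (_ * _)%N.
rewrite -[RHS]muln1 -[in RHS](card_ord j.+1) -sum_nat_const -sum1_card.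
by rewrite (big_ord_widen n.+1 (fun=> 1%N)).
Qed.

Lemma value0 g mu : value s g mu 0 =
  (fdes_rep s g + \sum_(j < n.+1) weight r s n j * mu j)%N.
Proof. by rewrite /value. Qed.

Lemma value_antitone g mu i j : (i <= j <= n)%N ->
  (value s g mu j <= value s g mu i)%N.
Proof.
case/andP=> le_ij; elim: j le_ij => [|j IHj]; first by rewrite leqn0 => /eqP->.
rewrite leq_eqVlt => /predU1P[-> // | lt_ij lt_jn].
by apply: leq_trans (IHj lt_ij (ltnW lt_jn)); rewrite (value_step _ _ _ lt_jn) leq_addr.
Qed.

Lemma encode_le_value0 g mu x : (encode g mu x <= value s g mu 0)%N.
Proof. by apply: value_antitone; rewrite leq_ord. Qed.

Lemma leq_mu_value g mu (j : 'I_n.+1) : (mu j <= value s g mu 0)%N.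
Proof.
rewrite value0 (bigD1 j) //=; apply: leq_trans (leq_addl _ _).
apply: leq_trans (leq_addr _ _); rewrite /weight.
by case: ifP => _; rewrite leq_pmull.
Qed.

Lemma sum_encode_mod g mu : (colors g ord_max < m)%N ->
  (\sum_x encode g mu x %% m = col_rep s g)%N.
Proof.
move=> gm; rewrite (sum_encode (modn^~ m)); apply: eq_bigr => i _.
rewrite residue_nat -(modn_dvdm _ m_dvd_r) value_modr ?colornE ?leq_ord //.
  by rewrite modn_dvdm // mulnC addnC modnMDl.
by rewrite -[n]/(nat_of_ord (@ord_max n)) colornE.
Qed.

(** Modulo [p] the sum of the values is the sum of the colors plus [n.+1 * (m * mu ord_max)]. The
    extra term vanishes: [p * s %| r * n.+1] makes [p] divide [n.+1 * m]. *)
Lemma dvdn_sum_encode p g mu :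
    (p %| r)%N -> (p * s %| r * n.+1)%N -> (colors g ord_max < m)%N ->
  (p %| \sum_x encode g mu x)%N = (g \in Grpn r p n.+1).
Proof.
move=> pr psrn gm; rewrite inE (sum_encode id) /dvdn.
pose c i := (colors g i + m * mu ord_max)%N.
have -> : (\sum_(i < n.+1) value s g mu i = \sum_(i < n.+1) c i %[mod p])%N.
  apply: (big_ind2 (fun x y => x = y %[mod p])%N) => // [x1 x2 y1 y2 E1 E2|i _].
    by rewrite -modnDm E1 E2 modnDm.
  rewrite -(modn_dvdm _ pr) value_modr ?leq_ord ?modn_dvdm ?colornE //.
  by rewrite -[n]/(nat_of_ord (@ord_max n)) colornE.
rewrite big_split /= sum_nat_const card_ord mulnA addnC.
suff /dvdnP[k ->] : (p %| n.+1 * m)%N by rewrite mulnAC modnMDl.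
have s0 : (0 < s)%N by apply: dvdn_gt0 s_dvd_r.
by rewrite -(dvdn_pmul2r s0) -mulnA divnK // mulnC [X in (_ %| X)%N]mulnC mulnC.
Qed.

(** Decoding goes in stages: uniqueness of the sorting permutation gives [uncolored], division of
    the last value by [m] gives the last color and the last [mu], reduction modulo [r] gives the
    other colors, and the recurrence gives the other [mu]. *)
Lemma encode_inj g g' mu mu' :
    (colors g ord_max < m)%N -> (colors g' ord_max < m)%N ->
  encode g mu =1 encode g' mu' -> g = g' /\ mu =1 mu'.
Proof.
rewrite -!colornE /= => gm gm' eq_f; pose f := encode g mu.
have es : uncolored g = uncolored g'.
  apply: (strictly_sorts_inj (@before_irr _ f) (@before_trans _ f) (@before_total _ f)).
    by apply: (@value_sorts r s n r_gt0 g mu) => // i le_in; rewrite /f encode_perm inordK.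
  by apply: (@value_sorts r s n r_gt0 g' mu') => // i le_in; rewrite /f eq_f encode_perm inordK.
have eq_v i : (i <= n)%N -> value s g mu i = value s g' mu' i.
  move=> le_in; rewrite -[i](@inordK n) // -!encode_perm -es.
  by rewrite -eq_f es.
have := eq_v n (leqnn n); rewrite !value_last // => eq_n.
have eq_cn : colorn g n = colorn g' n.
  by have := congr1 (modn^~ m) eq_n; rewrite
    ![(m * _)%N]mulnC ![(colorn _ _ + _)%N]addnC !modnMDl !modn_small.
have eq_mn : mu ord_max = mu' ord_max.
  by move/eqP: eq_n; rewrite eq_cn eqn_add2l eqn_pmul2l // => /eqP.
have eq_c i : (i <= n)%N -> colorn g i = colorn g' i.
  move=> le_in; have := congr1 (modn^~ r) (eq_v i le_in).
  rewrite !value_modr // eq_mn => /eqP; rewrite eqn_modDr.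
  by rewrite !modn_small ?colorn_lt // => /eqP.
have eg : g = g'.
  have: colors g = colors g'.
    by apply/ffunP => i; apply: val_inj; rewrite /= -!colornE eq_c ?leq_ord.
  by case: (g) (g') es => c t [c' t'] /= -> ->.
split=> // j; have [jn|jn] := eqVneq (val j) n.
  by have -> : j = ord_max by apply: val_inj.
have lt_jn : (j < n)%N by rewrite ltn_neqAle jn leq_ord.
have := eq_v j (ltnW lt_jn); rewrite !(value_step _ _ _ lt_jn) eq_v // -eg => /eqP.
by rewrite eqn_add2l eqn_add2r eqn_pmul2l // eqn_add2l inord_val => /eqP.
Qed.

Lemma encode_onto f : exists g, exists2 mu,
  (colors g ord_max < m)%N & encode g mu =1 f.
Proof.
have [t t_sorts] := strictly_sorts_exists
  (@before_irr _ f) (@before_trans _ f) (@before_total _ f).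
pose b i := f (t (inord i)).
have b_step i : (i < n)%N ->
    (b i.+1 < b i)%N || (b i == b i.+1) && (t (inord i) < t (inord i.+1))%N.
  move=> lt_in; have le_in := ltnW lt_in; apply: t_sorts.
  by rewrite !inordK.
have b_last i : (i <= n)%N -> (b n <= b i)%N.
  move=> le_in; rewrite -(subKn le_in); elim: (n - i)%N (leq_subr i n) => [|k IHk] lt_kn.
    by rewrite subn0.
  apply: leq_trans (IHk (ltnW lt_kn)) _.
  have lt_n : (n - k.+1 < n)%N by lia.
  have := b_step _ lt_n; have -> : (n - k.+1).+1 = (n - k)%N by lia.
  by case/orP=> [/ltnW // | /andP[/eqP-> _]].
(* The smallest value has to be the last color plus [m * mu ord_max], so [M] is the last [mu]. Once
   [M * m] is removed, the values modulo [r] are the colors. *)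
pose M := (b n %/ m)%N.
have leM : (M * m <= b n)%N by rewrite leq_divM.
have c_lt i : ((b i - M * m) %% r < r.-1.+1)%N by rewrite prednK ?ltn_pmod.
pose g := CPerm [ffun i : 'I_n.+1 => Ordinal (c_lt i)] t.
have gE i : (i <= n)%N -> colorn g i = ((b i - M * m) %% r)%N.
  by move=> le_in; rewrite colorn_inord // ffunE /= inordK.
have bn : (b n - M * m = b n %% m)%N by rewrite {1}(divn_eq (b n) m) addKn.
have gm : (colorn g n < m)%N.
  rewrite gE // bn; apply: leq_ltn_trans (leq_mod _ _) _; exact: ltn_pmod.
pose h i := (inord i : 'I_n.+1) \in HDes g.
(* By the recurrence, the quotient by [r] of a drop is the descent bit plus [mu j]. The natural
   subtraction is exact by [hD] below. *)
pose mu (j : 'I_n.+1) := if (j : nat) == n then M else ((b j - b j.+1) %/ r - h j)%N.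
exists g; exists mu; first by rewrite -colornE.
suff vE i : (i <= n)%N -> value s g mu i = b i.
  by move=> x; rewrite /encode vE ?leq_ord // /b inord_val permKV.
move=> le_in; rewrite -(subKn le_in); elim: (n - i)%N (leq_subr i n) => [|k IHk] lt_kn.
  rewrite subn0 value_last // gE // bn /mu eqxx modn_small.
    by rewrite mulnC addnC /M -divn_eq.
  by apply: leq_trans (ltn_pmod _ m_gt0) _; apply: dvdn_leq.
have lt_n : (n - k.+1 < n)%N by lia.
rewrite (value_step _ _ _ lt_n); move: lt_n; set j := (n - k.+1)%N => lt_jn.
have Ej : j.+1 = (n - k)%N by rewrite /j; lia.
have le_jn := ltnW lt_jn.
rewrite Ej IHk 1?ltnW // -Ej /mu inordK // (ltn_eqF lt_jn) -/(h j).
have le_b : (b j.+1 <= b j)%N by case/orP: (b_step j lt_jn) => [/ltnW // | /andP[/eqP->]].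
set D := (b j - b j.+1)%N; have bE : b j = (b j.+1 + D)%N by rewrite subnKC.
have res : residue r ((colorn g j)%:Z - (colorn g j.+1)%:Z) = (D %% r)%N.
  apply: residueB_eq; rewrite !gE // modnDml modn_mod bE -addnBAC //.
  exact: leq_trans leM (b_last _ lt_jn).
(* At a descent the colors agree, so [r] divides the drop [D]. A tie would contradict the order in
   which [t] lists ties, so [D] is positive and hence at least [r]. *)
have hD : h j -> (0 < D %/ r)%N.
  rewrite /h HDesP // => /andP[/eqP ec lt_t].
  have Dr : (D %% r = 0)%N by rewrite -res ec subrr /residue mod0z.
  rewrite divn_gt0 //; apply: dvdn_leq; last exact/eqP.
  have := b_step j lt_jn; rewrite -[t (inord j)]/(uncolored g (inord j)).
  by rewrite -[t (inord j.+1)]/(uncolored g (inord j.+1))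
    [X in _ || _ && X]ltnNge (ltnW lt_t) andbF orbF subn_gt0.
rewrite res subnKC; last by case: (h j) hD => // ->.
by rewrite [(r * _)%N]mulnC -divn_eq bE.
Qed.

End Encoding.

(** * Representatives of the cosets of [Cs] *)

Section CosetRepresentatives.
Variables (r p s n : nat).
Hypotheses (r_gt0 : (0 < r)%N) (p_dvd_r : (p %| r)%N) (s_dvd_r : (s %| r)%N).
Hypothesis ps_dvd_rn : (p * s %| r * n.+1)%N.
Local Notation m := (r %/ s)%N.
Implicit Types g : cperm r n.+1.

(** The generator of [Cs] adds [m] to every color modulo [r], so exactly one member of each coset
    has its last color below [m]. *)
Definition reduced_reps : {set cperm r n.+1} :=
  [set g in Grpn r p n.+1 | (colors g ord_max < m)%N].

Let s_gt0 : (0 < s)%N. Proof. exact: dvdn_gt0 s_dvd_r. Qed.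

Let mE : (m * s = r)%N. Proof. exact: divnK. Qed.

Let m_dvd_r : (m %| r)%N. Proof. by rewrite -{2}mE dvdn_mulr. Qed.

Let z := Cs_gen r s n.+1.

Lemma uncolored_Cs_genX k : uncolored (z ^+ k)%g = 1%g.
Proof. by elim: k => [|k IHk]; rewrite ?expg0 // expgS /= IHk mulg1. Qed.

Lemma colors_Cs_genX_mul k g i :
  (colors (z ^+ k * g)%g i = (colors g i + m * k) %% r :> nat)%N.
Proof.
elim: k => [|k IHk].
  rewrite expg0 mul1g muln0 addn0 modn_small //.
  by rewrite -[X in (_ < X)%N](prednK r_gt0).
rewrite expgS -mulgA; move: (z ^+ k * g)%g IHk => h IHk.
rewrite [colors _]/= !ffunE /= inordK ?prednK ?ltn_pmod //.
by rewrite IHk [X in (_ %% X = _)%N]prednK // modnDm mulnSr addnA.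
Qed.

Lemma Cs_genX_eq1 k : (r %| m * k)%N -> (z ^+ k = 1)%g.
Proof.
move=> rk; have E : colors (z ^+ k)%g = colors (1 : cperm r n.+1)%g.
  apply/ffunP => i; apply: val_inj; rewrite /= -[(z ^+ k)%g]mulg1.
  by rewrite colors_Cs_genX_mul !ffunE add0n; apply/eqP.
have := uncolored_Cs_genX k; move: E.
by case: (z ^+ k)%g => c t /= -> ->.
Qed.

Let norm_Cs g : g \in 'N(Cs r s n.+1)%g.
Proof. by apply: (subsetP (Cs_norm _ [set: _])); rewrite inE. Qed.

(** Last colors within a coset are congruent modulo [m]. Both being below [m], they agree, so the
    power of the generator relating the two elements has [r %| m * k] and is trivial. *)
Lemma coset_reduced_reps_inj :
  {in reduced_reps &, injective (coset (Cs r s n.+1))}.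
Proof.
move=> g h; rewrite !inE => /andP[_ gm] /andP[_ hm].
move/(rcoset_kercosetP (norm_Cs g) (norm_Cs h)).
case/rcosetP => _ /cycleP[k ->] eg; rewrite eg.
move: gm; rewrite eg colors_Cs_genX_mul; set c := colors h ord_max => gm.
have ec : ((c + m * k) %% r = c)%N.
  rewrite -[LHS](modn_small gm) modn_dvdm // mulnC addnC modnMDl.
  by rewrite modn_small.
rewrite Cs_genX_eq1 ?mul1g //.
have cr : (c < r)%N by rewrite -[X in (_ < X)%N](prednK r_gt0).
have /eqP := ec; rewrite -{2}(modn_small cr) -{2}[nat_of_ord c]addn0 eqn_modDl.
by rewrite mod0n.
Qed.

Lemma coset_reduced_reps :
  coset (Cs r s n.+1) @: reduced_reps = Grpsn r p s n.+1.
Proof.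
rewrite /Grpsn /quotient morphimEsub ?Cs_norm //.
apply/eqP; rewrite eqEsubset; apply/andP; split.
  by apply: imsetS; apply/subsetP => g; rewrite inE => /andP[].
apply/subsetP => _ /imsetP[g gG ->].
(* This power adds [r - m * (c %/ m)] to the last color [c], which becomes [c %% m]. *)
pose k := (s - colors g ord_max %/ m)%N; set c := colors g ord_max in k *.
have gen_k : (z ^+ k)%g \in Cs r s n.+1 by apply: mem_cycle.
have m_gt0 : (0 < m)%N by apply: dvdn_gt0 m_dvd_r.
apply/imsetP; exists (z ^+ k * g)%g; last first.
  by apply/rcoset_kercosetP; rewrite // ?norm_Cs // mem_rcoset invMg mulKVg groupV.
rewrite inE; apply/andP; split.
  pose G := Group (group_set_Grpn n.+1 r_gt0 p_dvd_r).
  rewrite -[Grpn _ _ _]/(gval G) groupM //.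
  by apply: (subsetP (Cs_sub_Grpn r_gt0 s_gt0 p_dvd_r s_dvd_r ps_dvd_rn)).
rewrite colors_Cs_genX_mul -/c /k mulnBr mE.
have le_c : (m * (c %/ m) <= c)%N by rewrite mulnC leq_divM.
have cr : (c < r)%N by rewrite -[X in (_ < X)%N](prednK r_gt0).
have -> : (c + (r - m * (c %/ m)) = c %% m + r)%N.
  by have := divn_eq c m; rewrite [(_ * m)%N]mulnC; lia.
rewrite modnDr; apply: leq_ltn_trans (leq_mod _ _) _; exact: ltn_pmod.
Qed.

Lemma sum_Grpsn (V : nmodType) (F : nat -> nat -> nat -> V) :
  \sum_(x in Grpsn r p s n.+1) F (fdes x) (fmaj x) (colstat x) =
  \sum_(g in reduced_reps) F (fdes_rep s g) (fmaj_rep s g) (col_rep s g).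
Proof.
rewrite -coset_reduced_reps big_imset /=; last exact: coset_reduced_reps_inj.
apply: eq_bigr => g _.
have /(_ g)[] := @stats_repr r s n.+1 r_gt0 s_dvd_r (coset (Cs r s n.+1) g) _ isT.
  by rewrite val_coset ?rcoset_refl.
by move=> -> -> ->.
Qed.

End CosetRepresentatives.

(** * The encoding as an identity between finite sums *)

Section EncodingSum.
Variables (r p s n N : nat).
Hypotheses (r_gt0 : (0 < r)%N) (p_dvd_r : (p %| r)%N) (s_dvd_r : (s %| r)%N).
Hypothesis ps_dvd_rn : (p * s %| r * n.+1)%N.
Local Notation m := (r %/ s)%N.
Local Notation maps := {ffun 'I_n.+1 -> 'I_N.+1}.

(** The entries of [mu] are capped at [N] to make the set finite. No pair is lost, because the
    weights are positive and so the value at 0 bounds every entry. *)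
Let pairs : {set cperm r n.+1 * maps} :=
  [set u : cperm r n.+1 * maps | (u.1 \in reduced_reps r p s n)
                               & (value s u.1 (fun j => u.2 j) 0 <= N)%N].

Let code (u : cperm r n.+1 * maps) : maps :=
  [ffun x => inord (encode s u.1 (fun j => u.2 j) x)].

Let code_val u x : u \in pairs -> code u x = encode s u.1 (fun j => u.2 j) x :> nat.
Proof.
rewrite inE => /andP[_ v0]; rewrite ffunE inordK // ltnS.
exact: leq_trans (encode_le_value0 _ _ _ _) v0.
Qed.

Let code_inj : {in pairs &, injective code}.
Proof.
move=> u v u_in v_in eq_c.
have eq_e : encode s u.1 (fun j => u.2 j) =1 encode s v.1 (fun j => v.2 j).
  by move=> x; rewrite -!code_val // eq_c.
move: u_in v_in; rewrite !inE => /andP[/andP[_ um] _] /andP[/andP[_ vm] _].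
have [] := encode_inj r_gt0 s_dvd_r um vm eq_e.
case: u v {um vm eq_c eq_e} => [g mu] [h nu] /= -> eq_mu.
by congr pair; apply/ffunP => j; apply: val_inj; apply: eq_mu.
Qed.

Let code_onto : code @: pairs = [set f : maps | p %| \sum_x f x]%N.
Proof.
apply/setP => f; rewrite inE; apply/imsetP/idP => [[u u_in ->] | pf].
  under eq_bigr do rewrite code_val //.
  move: u_in; rewrite !inE => /andP[/andP[gG gm] _].
  by rewrite (dvdn_sum_encode r_gt0 s_dvd_r) // inE.
have [g [mu gm eq_f]] := encode_onto r_gt0 s_dvd_r (fun x => f x).
have v0 : (value s g mu 0 <= N)%N.
  have := eq_f (uncolored g ord0).
  by rewrite encode_perm /= => ->; rewrite leq_ord.
have mu_le j : (mu j <= N)%N.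
  exact: leq_trans (leq_mu_value r_gt0 s_dvd_r _ _ _) v0.
pose nu : maps := [ffun j => inord (mu j)].
have nuE : (fun j => nu j : nat) = mu.
  by apply: boolp.funext => j; rewrite ffunE inordK // ltnS.
have gnu : (g, nu) \in pairs.
  rewrite !inE /= nuE v0 gm !andbT; move: pf.
  under eq_bigr do rewrite -eq_f.
  by rewrite (dvdn_sum_encode r_gt0 s_dvd_r) // inE.
exists (g, nu) => //; apply/ffunP => x; apply: val_inj.
by rewrite [RHS]code_val //= nuE eq_f.
Qed.

Lemma sum_encoding (V : nmodType) (F : nat -> nat -> V) :
  \sum_(f : maps | (p %| \sum_x f x)%N) F (\sum_x f x)%N (\sum_x f x %% m)%N =
  \sum_(g in reduced_reps r p s n)
    \sum_(mu : maps | (fdes_rep s g + \sum_(j < n.+1) weight r s n j * mu j <= N)%N)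
      F (fmaj_rep s g + \sum_(j < n.+1) j.+1 * (weight r s n j * mu j))%N
        (col_rep s g).
Proof.
rewrite pair_big_dep.
transitivity (\sum_(f in code @: pairs) F (\sum_x f x)%N (\sum_x f x %% m)%N).
  by apply: eq_bigl => f; rewrite code_onto inE.
rewrite big_imset //; apply: eq_big => [u|u u_in]; first by rewrite inE value0.
have -> : (\sum_x code u x = \sum_x encode s u.1 (fun j => u.2 j) x)%N.
  by apply: eq_bigr => x _; rewrite code_val.
have -> : (\sum_x code u x %% m = \sum_x encode s u.1 (fun j => u.2 j) x %% m)%N.
  by apply: eq_bigr => x _; rewrite code_val.
rewrite (sum_encode _ id) sum_value sum_encode_mod //.
by move: u_in; rewrite !inE => /andP[/andP[]].
Qed.

End EncodingSum.

(** * Power series modulo a power of the variable *)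

Section SeriesModXn.
Variables (R : comUnitRingType) (N : nat).
Implicit Types f g h : fps R.

(** Congruence modulo [X^N], under which a geometric series may be replaced by a finite sum. *)
Definition eqmod f g := forall k, (k < N)%N -> fcoef f k = fcoef g k.

Lemma eqmodM f f' g g' : eqmod f f' -> eqmod g g' -> eqmod (f * g) (f' * g').
Proof.
move=> ff gg k kN; rewrite !fcoefM; apply: eq_bigr => i _.
by rewrite ff ?gg //; apply: leq_ltn_trans kN; rewrite ?leq_subr // -ltnS.
Qed.

Lemma eqmod_prod I (s : seq I) (P : pred I) (F G : I -> fps R) :
  (forall i, P i -> eqmod (F i) (G i)) ->
  eqmod (\prod_(i <- s | P i) F i) (\prod_(i <- s | P i) G i).
Proof. by move=> FG; elim/big_ind2: _ => // *; apply: eqmodM. Qed.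

Lemma unit_1subXnM i f : (0 < i)%N -> 1 - fpsX ^+ i * f \is a GRing.unit.
Proof.
move=> i0; rewrite fps_unitE fcoefD -mulrN fcoefXnM i0 addr0.
by rewrite fcoef1 unitr1.
Qed.

(** The product telescopes to 1 minus the [N]-th power of [fpsX ^+ i * f], which is divisible by
    [X^N] as [i > 0]. *)
Lemma eqmod_geometric i f : (0 < i)%N ->
  eqmod ((1 - fpsX ^+ i * f) * \sum_(e < N) (fpsX ^+ i * f) ^+ e) 1.
Proof.
move=> i0 k kN; rewrite -opprB mulNr -subrX1 opprB exprMn -exprM.
rewrite fcoefD -mulrN fcoefXnM ifT ?addr0 //.
by apply: leq_trans kN _; rewrite leq_pmull.
Qed.

Lemma eqmod_div f g h : g \is a GRing.unit -> eqmod (g * h) 1 ->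
  eqmod (f / g) (f * h).
Proof.
move=> Ug gh1; have : eqmod (f / g * 1) (f / g * (g * h)).
  by apply: eqmodM => // k /gh1.
by rewrite mulr1 mulrA divrK.
Qed.

End SeriesModXn.

(** * The embedding of constants into power series *)

Section Constants.
Variable R : comNzRingType.
Implicit Types x y : R.

Lemma fpsCM x y : fpsC (x * y) = fpsC x * fpsC y.
Proof.
apply: fpsP => -[|k]; rewrite fcoefM ?big_ord1 //= big1 // => i _.
by case: (nat_of_ord i) (ltn_ord i) => [|j] /= _; rewrite ?mulr0 ?mul0r.
Qed.

Lemma fpsCD x y : fpsC (x + y) = fpsC x + fpsC y.
Proof. by apply: fpsP => -[|k] /=; rewrite ?addr0. Qed.

Lemma fpsC0 : fpsC 0 = 0 :> fps R.
Proof. by apply: fpsP => -[]. Qed.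

Lemma fpsC1 : fpsC 1 = 1 :> fps R.
Proof. by apply: fpsP => -[]. Qed.

Lemma fpsCX x n : fpsC (x ^+ n) = fpsC x ^+ n.
Proof. by elim: n => [|n IHn]; rewrite ?expr0 ?fpsC1 // !exprS fpsCM IHn. Qed.

Lemma fcoefXnMC j x k : fcoef (fpsX ^+ j * fpsC x) k = if k == j then x else 0.
Proof.
rewrite fcoefXnM; case: ltngtP => [//| lt_jk|->]; last by rewrite subnn.
by rewrite /=; case: (k - j)%N (subn_gt0 j k); rewrite lt_jk.
Qed.

Lemma fcoef_sumXC (v : nat -> R) k : fcoef (fps_sumX (fun j => fpsC (v j))) k = v k.
Proof.
rewrite -(fcoef_sumX _ (ltnSn k)) fcoef_sum (bigD1 ord_max) //.
rewrite big1 => [|i]; first by rewrite Monoid.mulm1 fcoefXnMC eqxx.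
by rewrite -val_eqE eq_sym fcoefXnMC => /negbTE ->.
Qed.

End Constants.

(** * The coefficient of [t^k] on either side *)

Lemma sum_qnat (R : comNzRingType) (q a : R) m k : (0 < m)%N ->
  qnat (k %/ m + 1)%N (q ^+ m)
    + a * q * qnat (m - 1)%N (a * q) * qnat (k %/ m)%N (q ^+ m)
    + a * q ^+ (k %/ m * m + 1) * qnat (k %% m)%N (a * q)
  = \sum_(f < k.+1) q ^+ f * a ^+ (f %% m)%N.
Proof.
move=> m0.
(* On a block starting at a multiple of [m] the exponent of [a] restarts at 0. The range up to [k]
   splits into [k %/ m] full blocks and one of length [(k %% m).+1]. *)
have block Q e : (e <= m)%N ->
    \sum_(f < e) q ^+ (Q * m + f) * a ^+ ((Q * m + f) %% m) = q ^+ (Q * m) * qnat e (a * q).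
  move=> le_em; rewrite mulr_sumr; apply: eq_bigr => f _.
  rewrite modnMDl modn_small; last exact: leq_trans le_em.
  by rewrite exprD exprMn -mulrA [a ^+ _ * _]mulrC.
have qnatS e (x : R) : qnat e.+1 x = 1 + x * qnat e x.
  rewrite /qnat big_ord_recl expr0 mulr_sumr; congr (_ + _).
  by apply: eq_bigr => i _; rewrite -exprS.
have qnatSr e (x : R) : qnat e.+1 x = qnat e x + x ^+ e by rewrite /qnat big_ord_recr.
have blocks Q : \sum_(f < Q * m) q ^+ f * a ^+ (f %% m)%N = qnat Q (q ^+ m) * qnat m (a * q).
  elim: Q => [|Q IHQ]; first by rewrite mul0n /qnat !big_ord0 mul0r.
  rewrite mulSnr big_split_ord /= IHQ block // qnatSr.
  by rewrite mulrDl [(Q * m)%N]mulnC exprM.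
have -> : k.+1 = (k %/ m * m + (k %% m).+1)%N by rewrite addnS -divn_eq.
rewrite big_split_ord /= blocks block ?ltn_pmod // qnatS.
(* The constant terms of all blocks together form [qnat (k %/ m + 1) (q ^+ m)]; the rest gives the
   other two terms. *)
have -> : qnat m (a * q) = 1 + a * q * qnat (m - 1)%N (a * q).
  by rewrite -qnatS subn1 prednK.
rewrite addn1 qnatSr -exprM [(m * _)%N]mulnC addn1 exprSr.
by ring.
Qed.

(* The image of mono B C under fpsC is q^B a^C. *)
Definition mono (B C : nat) : fps (fps int) := fpsX ^+ B * fpsC fpsX ^+ C.

Lemma mono_sum I (s : seq I) (B C : I -> nat) :
  \prod_(i <- s) mono (B i) (C i) = mono (\sum_(i <- s) B i) (\sum_(i <- s) C i).
Proof. by rewrite /mono big_split /= !expr_sum. Qed.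

Lemma fcoef_mono B C j : fcoef (mono B C) j = if j == B then fpsX ^+ C else 0.
Proof. by rewrite /mono -fpsCX fcoefXnMC. Qed.

Lemma mono_varqa B C : varq ^+ B * vara ^+ C = fpsC (mono B C).
Proof. by rewrite /varq /vara -(fpsCX fpsX) -(fpsCX (fpsC fpsX)) -fpsCM. Qed.

Lemma fcoef_keep_q p (F : Ztqa) k I (s : seq I) (B C : I -> nat) :
    fcoef F k = \sum_(i <- s) mono (B i) (C i) ->
  fcoef (keep_q p F) k = \sum_(i <- s | (p %| B i)%N) mono (B i) (C i).
Proof.
move=> Fk; apply: fpsP => j /=; rewrite Fk !fcoef_sum [RHS]big_mkcond.
case: ifP => pj; [apply: eq_bigr | rewrite big1 //] => i _;
  by rewrite fcoef_mono; case: eqP => [<-|_]; rewrite ?pj ?if_same.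
Qed.

(** Here [e] is the exponent taken from [1 / (1 - t)]: summing over it turns the condition that an
    exponent equals [k] into at most [k]. *)
Lemma sum_shift_eq (V : nmodType) d k (x : V) :
  \sum_(e < k.+1) (if k == (d + e)%N then x else 0) = if (d <= k)%N then x else 0.
Proof.
case: leqP => [le_dk | lt_kd]; last first.
  by rewrite big1 // => e _; case: eqP => // kE; move: lt_kd; rewrite kE ltnNge leq_addr.
rewrite -big_mkcond (big_pred1 (inord (k - d))) // => e /=.
by rewrite -val_eqE /= inordK ?ltnS ?leq_subr //; lia.
Qed.

Lemma fcoef_keep_q_powers p m n k : (0 < m)%N ->
  let q := varq in let a := vara in
  fcoef (keep_q p
    (fps_sumX (fun k =>
       (qnat (k %/ m + 1)%N (q ^+ m)
        + a * q * qnat (m - 1)%N (a * q) * qnat (k %/ m)%N (q ^+ m)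
        + a * q ^+ (k %/ m * m + 1) * qnat (k %% m)%N (a * q)) ^+ n))) k
  = \sum_(f : {ffun 'I_n -> 'I_k.+1} | (p %| \sum_x f x)%N)
      mono (\sum_x f x) (\sum_x f x %% m).
Proof.
move=> m0 q a; apply: fcoef_keep_q.
pose v j := \sum_(f : {ffun 'I_n -> 'I_j.+1}) mono (\sum_x f x) (\sum_x f x %% m).
rewrite -[RHS]/(v k) -(fcoef_sumXC v); congr (fcoef (fps_sumX _) k).
(* Expanding the power, written as a product over ['I_n], chooses one exponent per factor, that is,
   a map. *)
apply: boolp.funext => j; rewrite sum_qnat // -[X in _ ^+ X](card_ord n) -prodr_const.
rewrite bigA_distr_bigA (big_morph _ (@fpsCD _) (fpsC0 _)); apply: eq_bigr => f _.
rewrite -mono_sum (big_morph _ (@fpsCM _) (fpsC1 _)); apply: eq_bigr => x _.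
by rewrite mono_varqa.
Qed.

Lemma fcoef_div_geometric (w : nat -> nat) n k (I : finType) (A : {set I})
    (D M C : I -> nat) : (forall j, 0 < w j)%N ->
  fcoef ((\sum_(g in A) vart ^+ D g * varq ^+ M g * vara ^+ C g)
     / ((1 - vart) * \prod_(j < n) (1 - vart ^+ w j * varq ^+ (j.+1 * w j)))) k
  = \sum_(g in A)
      \sum_(mu : {ffun 'I_n -> 'I_k.+1} | (D g + \sum_(j < n) w j * mu j <= k)%N)
        mono (M g + \sum_(j < n) j.+1 * (w j * mu j)) (C g).
Proof.
move=> w0; have tE : vart = fpsX ^+ 1 * 1 by rewrite mulr1.
rewrite [in 1 - vart]tE.
pose x j : Ztqa := vart ^+ w j * varq ^+ (j.+1 * w j).
(* [W] inverts the denominator modulo [t^(k+1)]; exponents up to [k] suffice because every [w j] is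
   positive. *)
pose W := (\sum_(e < k.+1) (fpsX ^+ 1 * 1) ^+ e) * \prod_(j < n) \sum_(e < k.+1) x j ^+ e.
rewrite (@eqmod_div _ k.+1 _ _ W) //; first last.
- rewrite /W mulrACA -big_split -[X in eqmod _ _ X]mulr1.
  apply: eqmodM; first exact: eqmod_geometric.
  have E : 1 = \prod_(j < n) 1 :> Ztqa by rewrite big1.
  rewrite [X in eqmod _ _ X]E.
  by apply: eqmod_prod => j _; apply: eqmod_geometric.
- rewrite unitrM unit_1subXnM //; apply: (big_ind (fun y => y \is a GRing.unit)).
  + exact: unitr1.
  + by move=> y z Uy Uz; rewrite unitrM Uy.
  + by move=> j _; apply: unit_1subXnM.
rewrite mulr_suml fcoef_sum; apply: eq_bigr => g _.
rewrite /W bigA_distr_bigA mulr_sumr mulr_sumr fcoef_sum [RHS]big_mkcond.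
apply: eq_bigr => mu _; rewrite -sum_shift_eq mulr_suml mulr_sumr fcoef_sum.
apply: eq_bigr => e _; rewrite -fcoefXnMC -mono_varqa.
congr (fcoef _ k); rewrite mulr1 -exprM mul1n.
have -> : \prod_(j < n) x j ^+ mu j = vart ^+ (\sum_(j < n) w j * mu j)
    * varq ^+ (\sum_(j < n) j.+1 * (w j * mu j)).
  rewrite !expr_sum -big_split; apply: eq_bigr => j _.
  by rewrite exprMn -!exprM mulnA.
have monomialE (S : comNzRingType) (u v z : S) d1 d2 d3 e1 e2 f1 :
    u ^+ d1 * v ^+ e1 * z ^+ f1 * (u ^+ d3 * (u ^+ d2 * v ^+ e2)) =
    u ^+ (d1 + d2 + d3) * (v ^+ (e1 + e2) * z ^+ f1) by rewrite !exprD; ring.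
exact: monomialE.
Qed.

(** * The denominator as a product over weights, and the conclusion *)

Lemma prod_weight (S : comNzRingType) (t q : S) r s n (m := (r %/ s)%N) :
  (1 - t) * (\prod_(1 <= j < n.+1) (1 - t ^+ r * q ^+ (j * r)))
    * (1 - t ^+ m * q ^+ (n.+1 * m))
  = (1 - t) *
    \prod_(j < n.+1) (1 - t ^+ weight r s n j * q ^+ (j.+1 * weight r s n j)).
Proof.
rewrite -mulrA big_ord_recr /= [weight r s n n]/weight eqxx -/m; congr (_ * (_ * _)).
rewrite big_add1 big_mkord; apply: eq_bigr => j _.
by rewrite /weight ltn_eqF.
Qed.

Theorem theorem5p4 (r p s n : nat)
    (hr : (0 < r)%N) (hp : (0 < p)%N) (hs : (0 < s)%N) (hn : (0 < n)%N)
    (hpr : (p %| r)%N) (hsr : (s %| r)%N) (hpsrn : (p * s %| r * n)%N) :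
  let m := (r %/ s)%N in
  let t := vart in
  let q := varq in
  let a := vara in
  keep_q p
    (fps_sumX (fun k =>
       (qnat (k %/ m + 1)%N (q ^+ m)
        + a * q * qnat (m - 1)%N (a * q) * qnat (k %/ m)%N (q ^+ m)
        + a * q ^+ (k %/ m * m + 1) * qnat (k %% m)%N (a * q)) ^+ n))
  = (\sum_(g in Grpsn r p s n) t ^+ fdes g * q ^+ fmaj g * a ^+ colstat g)
    / ((1 - t) * (\prod_(1 <= j < n) (1 - t ^+ r * q ^+ (j * r)))
       * (1 - t ^+ m * q ^+ (n * m))).
Proof.
move=> m t q a; case: n hn hpsrn => // n _ hpsrn.
have m0 : (0 < m)%N by rewrite divn_gt0 // dvdn_leq.
have w0 j : (0 < weight r s n j)%N by rewrite /weight; case: ifP.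
have sE := sum_Grpsn hr hpr hsr hpsrn (fun x y z => t ^+ x * q ^+ y * a ^+ z).
have dE := prod_weight t q r s n.
apply: etrans (esym (f_equal2 (fun x y => x / y) sE dE)).
(* Both coefficients of [t^k] are now finite sums of monomials, matched by the bijection with
   [N = k]. *)
apply: fpsP => k; apply: etrans (fcoef_keep_q_powers _ _ _ m0) _.
apply: etrans (esym (@fcoef_div_geometric (weight r s n) n.+1 k _ (reduced_reps r p s n)
  (@fdes_rep r s n.+1) (@fmaj_rep r s n.+1) (@col_rep r s n.+1) w0)).
exact: sum_encoding.
Qed.
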